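(* Let $N\in\mathbb{N}$, let $w=(w_1,\dots,w_N)$ and $p=(p_1,\dots,p_N)$ be probability vectors with strictly positive entries, let $\lambda>0$, and let $T_1,\dots,T_N$ be independent with $T_i\sim\mathrm{Exp}(\lambda p_i)$ (rate $\lambda p_i$). Let $M_N(t)=\sum_{i=1}^N w_i\mathbf{1}_{\{T_i\le t\}}$, $m_N(t)=\mathbb{E}[M_N(t)]$ and $w_N^\ast=\max_{1\le i\le N}w_i$. Then for every $t\ge 0$ and every $x>0$, \[ \mathbb{P}\bigl(|M_N(t)-m_N(t)|\ge x\bigr)\le 2\exp\left(-\frac{x^2}{2\,\mathrm{Var}(M_N(t))+\frac23 w_N^\ast x}\right). \] In particular, since $\mathrm{Var}(M_N(t))\le w_N^\ast$, one has \[ \mathbb{P}\bigl(|M_N(t)-m_N(t)|\ge x\bigr)\le 2\exp\left(-\frac{x^2}{2w_N^\ast+\frac23 w_N^\ast x}\right). \]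
   Context: Weighted-threshold coupon collection: type $i\in\{1,\dots,N\}$ has weight $w_i>0$ and is discovered at the random time $T_i$, the first event time of an independent Poisson process of rate $\lambda p_i$, with $\sum_i w_i=\sum_i p_i=1$. $M_N(t)$ is the total weight of types discovered by time $t$. *)

(* Defs.v *)
From HB Require Import structures.
From mathcomp Require Import all_boot all_order all_algebra.
From mathcomp Require Import all_classical all_reals all_analysis.

Set Implicit Arguments.
Unset Strict Implicit.
Unset Printing Implicit Defensive.

Import Order.TTheory GRing.Theory Num.Theory.
Import numFieldNormedType.Exports.

Local Open Scope classical_set_scope.
Local Open Scope ring_scope.

Section independence.
Context d d' (Omega : measurableType d) (U : measurableType d') (R : realType).

(* Mutual independence: the product rule over every subfamily J of the finite
   family X. *)
Definition independent_RVs (P : probability Omega R) (I : finType)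
    (X : I -> {RV P >-> U}) : Prop :=
  forall (J : {set I}) (A : I -> set U),
    (forall i, i \in J -> measurable (A i)) ->
    P (\bigcap_(i in [set` J]) (X i @^-1` A i)) =
    (\prod_(i in J) P (X i @^-1` A i))%E.

End independence.

Section coupon_collection.
Context d (Omega : measurableType d) (R : realType) (P : probability Omega R).

Definition exponential_RV (rate : R) (X : {RV P >-> R}) : Prop :=
  forall A : set R, measurable A ->
    distribution P X A = exponential_prob rate A.

Variable N : nat.

Definition discovered_mass (w : 'I_N -> R) (T : 'I_N -> {RV P >-> R}) (t : R)
    : Omega -> R :=
  fun omega => \sum_(i < N) w i * \1_[set o | T i o <= t] omega.

Definition mean_mass (w : 'I_N -> R) (T : 'I_N -> {RV P >-> R}) (t : R) : R :=
  fine 'E_P[discovered_mass w T t].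

(* The default value 0 of the iterated maximum is harmless: weights are
   positive. *)
Definition max_weight (w : 'I_N -> R) : R := \big[Num.max/0]_(i < N) w i.

End coupon_collection.

(* Main.v *)
Require Import Defs.
From HB Require Import structures.
From mathcomp Require Import all_boot all_order all_algebra.
From mathcomp Require Import all_classical all_reals all_analysis.
From mathcomp Require Import ring lra.

Import Order.TTheory GRing.Theory Num.Theory.
Import numFieldNormedType.Exports.

Local Open Scope classical_set_scope.
Local Open Scope ring_scope.

(* By independence the random set of types discovered by time t has the law of
   a product of Bernoulli measures on subsets of {1, ..., N}, so everything
   reduces to finite sums over subsets. There, e^y <= 1 + y + y^2/(2(1 - u/3))
   for y <= u < 3 bounds the moment generating function of each centred summand,
   the product structure multiplies these bounds, and Markov's inequality with
   s = x / (V + c x / 3) gives Bernstein's bound for each tail. *)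

(** * Exponential inequalities from calculus *)

Lemma derive_ge0_ndecr {R : realType} (f df : R -> R) :
  (forall x : R, is_derive x (1 : R) f (df x)) -> (forall x, 0 <= df x) ->
  forall x y, x <= y -> f x <= f y.
Proof.
move=> fdf df_ge0 x y xy.
have [|c _ fE] := MVT_segment xy (fun z _ => fdf z).
  by apply: derivable_within_continuous => z _; exact: ex_derive.
by rewrite -subr_ge0 fE mulr_ge0// subr_ge0.
Qed.

Lemma derive_sign_min0 {R : realType} (f df : R -> R) :
  (forall x : R, is_derive x (1 : R) f (df x)) ->
  (forall x, 0 <= x -> 0 <= df x) -> (forall x, x <= 0 -> df x <= 0) ->
  forall x, f 0 <= f x.
Proof.
move=> fdf df_ge0 df_le0 x.
have cf (a b : R) : {within `[a, b], continuous f}.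
  by apply: derivable_within_continuous => z _; exact: ex_derive.
have [x0|/ltW x0] := leP 0 x; rewrite -subr_ge0.
  have [c] := MVT_segment x0 (fun z _ => fdf z) (cf _ _).
  rewrite in_itv/= => /andP[c0 _] ->.
  by rewrite mulr_ge0 ?subr_ge0// df_ge0.
have [c] := MVT_segment x0 (fun z _ => fdf z) (cf _ _).
rewrite in_itv/= => /andP[_ c0] fE.
by rewrite -opprB fE -mulNr mulr_ge0 ?subr_ge0// oppr_ge0 df_le0.
Qed.

(* The difference of the two sides is convex with a double zero at 0: its
   second derivative is (1 - e^x + x e^x) / 3. *)
Lemma expR_taylor2_le {R : realType} (x : R) :
  (1 - x / 3) * (expR x - 1 - x) <= x ^+ 2 / 2.
Proof.
pose f (y : R) := y ^+ 2 / 2 - (1 - y / 3) * (expR y - 1 - y).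
pose df (y : R) := (y + 2 + (y - 2) * expR y) / 3.
pose ddf (y : R) := (1 - expR y + y * expR y) / 3.
have fdf (y : R) : is_derive y (1 : R) f (df y).
  by rewrite /f; apply: is_derive_eq; rewrite /df /GRing.scale/=; field.
have dfddf (y : R) : is_derive y (1 : R) df (ddf y).
  by rewrite /df; apply: is_derive_eq; rewrite /ddf /GRing.scale/=; field.
have ddf_ge0 (y : R) : 0 <= ddf y.
  rewrite divr_ge0//.
  (* Multiplying [1 - y <= expR (- y)] by [expR y] gives [(1 - y) * expR y <= 1]. *)
  have := expR_ge1Dx (- y); rewrite -(ler_pM2r (expR_gt0 y)) -expRD.
  by rewrite addNr expR0; lra.
(* A nondecreasing [df] vanishing at 0 has the sign of its argument, so [f] is minimal at 0, where
   it vanishes. *)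
have df0 : df 0 = 0 by rewrite /df expR0; lra.
have df_ndecr := derive_ge0_ndecr df ddf dfddf ddf_ge0.
have := derive_sign_min0 f df fdf _ _ x.
rewrite {1}/f expR0 /f => H.
suff : 0 <= x ^+ 2 / 2 - (1 - x / 3) * (expR x - 1 - x) by lra.
apply: le_trans (H _ _); first lra.
- by move=> y y0; rewrite -df0 df_ndecr.
- by move=> y y0; rewrite -df0 df_ndecr.
Qed.

(** Since [expR x - 1 - x] is nonnegative, the factor [1 - x / 3] of the previous bound may be
    lowered to [1 - u / 3], which is positive and can be divided out. *)
Lemma expR_le_taylor2 {R : realType} (x u : R) : x <= u -> u < 3 ->
  expR x <= 1 + x + x ^+ 2 / (2 * (1 - u / 3)).
Proof.
move=> xu u3.
have u0 : 0 < 1 - u / 3 by lra.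
have : 0 <= expR x - 1 - x by have := expR_ge1Dx x; lra.
move=> /(ler_wpM2r)/(_ (1 - u / 3) (1 - x / 3)).
have -> : 1 - u / 3 <= 1 - x / 3 by lra.
move=> /(_ isT) /le_trans /(_ (expR_taylor2_le x)).
rewrite -ler_pdivlMl// => H.
have -> : x ^+ 2 / (2 * (1 - u / 3)) = (1 - u / 3)^-1 * (x ^+ 2 / 2).
  by rewrite invfM; ring.
by lra.
Qed.

(** The quadratic bound is averaged over the two values of a centred Bernoulli variable scaled by
    [a]: the linear terms cancel, the squares give the variance, and [1 + y <= expR y] finishes. *)
Lemma bernoulli_mgf_le {R : realType} (q a u : R) : 0 <= q <= 1 ->
  `|a| <= u -> u < 3 ->
  q * expR (a * (1 - q)) + (1 - q) * expR (a * (0 - q)) <=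
  expR (a ^+ 2 * (q * (1 - q)) / (2 * (1 - u / 3))).
Proof.
move=> /andP[q0 q1]; rewrite ler_norml => /andP[ua au] u3.
apply: le_trans (expR_ge1Dx _).
have h1 : expR (a * (1 - q)) <= _ := expR_le_taylor2 _ u _ u3.
have h2 : expR (a * (0 - q)) <= _ := expR_le_taylor2 _ u _ u3.
have /h1{}h1 : a * (1 - q) <= u by nra.
have /h2{}h2 : a * (0 - q) <= u by nra.
have q1' : 0 <= 1 - q by lra.
apply: le_trans (lerD (ler_wpM2l q0 h1) (ler_wpM2l q1' h2)) _.
by rewrite le_eqVlt; apply/orP; left; apply/eqP; ring.
Qed.

(** * Moments and tails of weighted Bernoulli sums, as finite sums over subsets *)

Section bernoulli_product.
Context {R : realType} {I : finType}.
Variable q : I -> R.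

Definition bernoulli_pmf (J : {set I}) : R :=
  \prod_i (if i \in J then q i else 1 - q i).

(** Distributivity: expanding the product on the right picks the [true] or the [false] term for each
    [i], and these choices are the subsets [J]. *)
Lemma sum_bernoulli_pmf_prod (g : I -> bool -> R) :
  \sum_(J : {set I}) bernoulli_pmf J * \prod_i g i (i \in J) =
  \prod_i (q i * g i true + (1 - q i) * g i false).
Proof.
rewrite bigA_distr; apply: eq_bigr => J _.
by rewrite -big_split; apply: eq_bigr => i _; case: (i \in J).
Qed.

(** One-coordinate marginal: every index other than [i] gets the factor 1 and contributes
    [q k + (1 - q k) = 1]. *)
Lemma sum_bernoulli_pmf1 (i : I) (g : bool -> R) :
  \sum_(J : {set I}) bernoulli_pmf J * g (i \in J) =
  q i * g true + (1 - q i) * g false.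
Proof.
apply: etrans (etrans (eq_bigr _ _) (sum_bernoulli_pmf_prod
  (fun k b => if k == i then g b else 1))) _ => [J _|].
  by rewrite -big_mkcond big_pred1_eq.
rewrite (bigD1 i)//= eqxx big1 ?mulr1// => k /negPf ->.
by rewrite !mulr1 addrC subrK.
Qed.

Lemma sum_bernoulli_pmf2 (i j : I) (g h : bool -> R) : i != j ->
  \sum_(J : {set I}) bernoulli_pmf J * (g (i \in J) * h (j \in J)) =
  (q i * g true + (1 - q i) * g false) * (q j * h true + (1 - q j) * h false).
Proof.
move=> ij.
apply: etrans (etrans (eq_bigr _ _) (sum_bernoulli_pmf_prod (fun k b =>
  (if k == i then g b else 1) * (if k == j then h b else 1)))) _ => [J _|].
  by rewrite big_split/= -!big_mkcond !big_pred1_eq.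
rewrite (bigD1 i)//= (bigD1 j)/=; last by rewrite eq_sym.
rewrite !eqxx (negPf ij) eq_sym (negPf ij) !mulr1 !mul1r big1 ?mulr1//.
move=> k /andP[/negPf -> /negPf ->].
by rewrite !mulr1 addrC subrK.
Qed.

Lemma bernoulli_sum_mean (a : I -> R) :
  \sum_(J : {set I}) bernoulli_pmf J * \sum_i a i * (i \in J)%:R =
  \sum_i a i * q i.
Proof.
under eq_bigr do rewrite mulr_sumr.
rewrite exchange_big/=; apply: eq_bigr => i _.
by rewrite (sum_bernoulli_pmf1 i (fun b => a i * b%:R)) /=; ring.
Qed.

(** In the expanded square, the terms with [j != i] factor into two centred means and vanish; the
    diagonal remains. *)
Lemma bernoulli_sum_variance (a : I -> R) :
  \sum_(J : {set I}) bernoulli_pmf J *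
    (\sum_i a i * ((i \in J)%:R - q i)) ^+ 2 =
  \sum_i a i ^+ 2 * (q i * (1 - q i)).
Proof.
under eq_bigr do rewrite expr2 big_distrlr/= mulr_sumr.
rewrite exchange_big/=; apply: eq_bigr => i _.
under eq_bigr do rewrite mulr_sumr.
rewrite exchange_big/= (bigD1 i)//= [X in _ + X]big1 ?addr0.
  rewrite (sum_bernoulli_pmf1 i (fun b =>
    (a i * (b%:R - q i)) * (a i * (b%:R - q i))))/=.
  by ring.
move=> j ji.
rewrite (sum_bernoulli_pmf2 i j (fun b => a i * (b%:R - q i))
  (fun b => a j * (b%:R - q j)))/=; last by rewrite eq_sym.
by ring.
Qed.

Hypothesis q01 : forall i, 0 <= q i <= 1.

Lemma bernoulli_pmf_ge0 (J : {set I}) : 0 <= bernoulli_pmf J.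
Proof.
by apply: prodr_ge0 => i _; case: ifP => _; have /andP[] := q01 i; lra.
Qed.

Lemma bernoulli_sum_chernoff (a : I -> R) (c V x s : R) :
  (forall i, `|a i| <= c) -> \sum_i a i ^+ 2 * (q i * (1 - q i)) <= V ->
  0 <= s -> s * c < 3 ->
  \sum_(J : {set I} | x <= \sum_i a i * ((i \in J)%:R - q i)) bernoulli_pmf J
  <= expR (s ^+ 2 * V / (2 * (1 - s * c / 3)) - s * x).
Proof.
move=> ac aV s0 sc.
set S := fun J : {set I} => \sum_i a i * ((i \in J)%:R - q i).
rewrite expRD expRN.
rewrite -ler_pdivrMr ?invr_gt0 ?expR_gt0// invrK mulr_suml.
(* Markov's inequality: [expR (s * x) <= expR (s * S J)] on the tail event, and the terms added
   outside it are nonnegative. *)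
apply: (@le_trans _ _ (\sum_(J : {set I}) bernoulli_pmf J * expR (s * S J))).
  rewrite big_mkcond/=; apply: ler_sum => J _.
  case: ifPn => xS.
    by rewrite ler_wpM2l ?bernoulli_pmf_ge0// ler_expR ler_wpM2l.
  by rewrite mulr_ge0 ?bernoulli_pmf_ge0 ?expR_ge0.
under eq_bigr do rewrite /S mulr_sumr expR_sum.
rewrite (sum_bernoulli_pmf_prod (fun i b =>
  expR (s * (a i * (b%:R - q i))))).
apply: (@le_trans _ _ (\prod_i expR ((s * a i) ^+ 2 * (q i * (1 - q i)) /
    (2 * (1 - s * c / 3))))).
  apply: ler_prod => i _; apply/andP; split.
    by have /andP[q0 q1] := q01 i; rewrite addr_ge0// mulr_ge0 ?expR_ge0//; lra.
  rewrite /= !(mulrA s).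
  apply: (bernoulli_mgf_le (q i) (s * a i) (s * c)) => //.
  by rewrite normrM ger0_norm// ler_wpM2l.
rewrite -expR_sum ler_expR -mulr_suml.
rewrite ler_wpM2r ?invr_ge0//; first by lra.
under eq_bigr do rewrite exprMn -mulrA.
by rewrite -mulr_sumr ler_wpM2l// sqr_ge0.
Qed.

Lemma bernoulli_sum_bernstein (a : I -> R) (c V x : R) : 0 < c ->
  (forall i, `|a i| <= c) -> \sum_i a i ^+ 2 * (q i * (1 - q i)) <= V ->
  0 < x ->
  \sum_(J : {set I} | x <= \sum_i a i * ((i \in J)%:R - q i)) bernoulli_pmf J
  <= expR (- (x ^+ 2 / (2 * V + 2 / 3 * c * x))).
Proof.
move=> c0 ac aV x0.
have V0 : 0 <= V.
  apply: le_trans aV; apply: sumr_ge0 => i _.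
  by have /andP[? ?] := q01 i; rewrite mulr_ge0 ?sqr_ge0// mulr_ge0//; lra.
have cx0 : 0 < c * x by rewrite mulr_gt0.
(* The optimal s = x / (V + c x / 3) is excluded when V = 0, where it equals
   3 / c; half of it already gives the bound there. *)
have [VE|V_gt0] : V = 0 \/ 0 < V.
  by move: V0; rewrite le_eqVlt => /predU1P[|]; auto.
  have := @bernoulli_sum_chernoff a c V x (3 / (2 * c)) ac aV.
  have -> : 3 / (2 * c) * c = 3 / 2 by field; lra.
  rewrite divr_ge0//; last by lra.
  have -> : (3 / 2 < 3 :> R) by lra.
  move=> /(_ isT isT) /le_trans; apply.
  by rewrite ler_expR VE le_eqVlt; apply/orP; left; apply/eqP; field; lra.
have D0 : 0 < 3 * V + c * x by lra.
have := @bernoulli_sum_chernoff a c V x (3 * x / (3 * V + c * x)) ac aV.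
rewrite divr_ge0; [|lra|lra].
have -> : 3 * x / (3 * V + c * x) * c < 3.
  by rewrite mulrAC ltr_pdivrMr//; lra.
move=> /(_ isT isT) /le_trans; apply.
(* With [D = 3 * V + c * x] and [s = 3 * x / D], one has [1 - s * c / 3 = 3 * V / D], so both
   exponents equal [- 3 * x ^+ 2 / (2 * D)]. *)
rewrite ler_expR le_eqVlt; apply/orP; left; apply/eqP; field.
by do ?[apply/andP; split]; lra.
Qed.

(** Union bound: the lower tail is the upper tail for the coefficients [- a i], which satisfy the
    same hypotheses. *)
Lemma bernoulli_sum_bernstein_norm (a : I -> R) (c V x : R) : 0 < c ->
  (forall i, `|a i| <= c) -> \sum_i a i ^+ 2 * (q i * (1 - q i)) <= V ->
  0 < x ->
  \sum_(J : {set I} | x <= `|\sum_i a i * ((i \in J)%:R - q i)|)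
    bernoulli_pmf J
  <= 2 * expR (- (x ^+ 2 / (2 * V + 2 / 3 * c * x))).
Proof.
move=> c0 ac aV x0.
have h1 := bernoulli_sum_bernstein a c V x c0 ac aV x0.
have h2 : _ <= _ := bernoulli_sum_bernstein (fun i => - a i) c V x c0 _ _ x0.
rewrite mulr2n mulrDl mul1r.
apply: le_trans (lerD h1 (h2 _ _)).
- rewrite [leLHS]big_mkcond/= [X in _ <= X + _]big_mkcond/=.
  rewrite [X in _ <= _ + X]big_mkcond/= -big_split/=; apply: ler_sum => J _.
  under [X in _ <= _ + (if _ <= X then _ else _)]eq_bigr do rewrite mulNr.
  rewrite sumrN ler_normr; have := bernoulli_pmf_ge0 J.
  by case: (x <= _) => /=; case: (x <= _) => /=; lra.
- by move=> i; rewrite normrN.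
- by under eq_bigr do rewrite sqrrN.
Qed.

End bernoulli_product.

(** * Law of the random set of occurring events *)

Section occurrence.
Context {d d' : measure_display} {Omega : measurableType d}.
Context {U : measurableType d'} {R : realType}.
Context {P : probability Omega R} {I : finType}.
Variables (X : I -> {RV P >-> U}) (A : I -> set U).
Hypothesis mA : forall i, measurable (A i).

Definition occ (omega : Omega) : {set I} :=
  [set i | `[< A i (X i omega) >]]%SET.

Definition occ_prob (i : I) : R := fine (P (X i @^-1` A i)).

Lemma measurable_occ1 (i : I) : measurable (X i @^-1` A i).
Proof. by rewrite -[_ @^-1` _]setTI; exact: measurable_funP. Qed.

Lemma occ_prob01 (i : I) : 0 <= occ_prob i <= 1.
Proof.
rewrite fine_ge0//= -lee_fin fineK ?probability_le1//.
  exact: measurable_occ1.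
by apply: fin_num_measure; exact: measurable_occ1.
Qed.

(** This form matches the product rule of [independent_RVs] for the full index set, with complements
    at the indices outside [J]. *)
Lemma preimage_occE (J : {set I}) : occ @^-1` [set J] =
  \bigcap_(i in [set` [set: I]%SET])
    (X i @^-1` (if i \in J then A i else ~` A i)).
Proof.
apply/seteqP; split=> [ o <- i _|o AJ] /=.
  by rewrite inE; case: asboolP.
apply/setP => i; rewrite inE; have := AJ i (finset.in_setT i).
by rewrite /=; case: ifP => _ ?; [rewrite asboolT|rewrite asboolF].
Qed.

Lemma measurable_occ_eq (J : {set I}) : measurable (occ @^-1` [set J]).
Proof.
rewrite preimage_occE; apply: fin_bigcap_measurable => // i _; case: ifP => _.
  exact: measurable_occ1.
by rewrite preimage_setC; exact: measurableC (measurable_occ1 i).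
Qed.

Hypothesis X_indep : independent_RVs X.

Lemma occ_law (J : {set I}) :
  P (occ @^-1` [set J]) = (bernoulli_pmf occ_prob J)%:E.
Proof.
rewrite preimage_occE (X_indep _ (fun i => if i \in J then A i else ~` A i)).
  rewrite /bernoulli_pmf -prodEFin.
  apply: eq_big => [i|i _]; first by rewrite inE.
  have fP : P (X i @^-1` A i) \is a fin_num.
    by apply: fin_num_measure; exact: measurable_occ1.
  rewrite /occ_prob; case: ifP => _; first by rewrite fineK.
  rewrite preimage_setC probability_setC; last exact: measurable_occ1.
  by rewrite EFinB fineK.
by move=> i _; case: ifP => // _; exact: measurableC.
Qed.

(** As [occ] takes finitely many values, [F \o occ] is a finite combination of indicators of its
    level sets, whose probabilities are given by [occ_law]. *)
Lemma occ_expectation (F : {set I} -> R) :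
  'E_P[F \o occ]%E = (\sum_(J : {set I}) bernoulli_pmf occ_prob J * F J)%:E.
Proof.
have FE o : ((F \o occ) o)%:E =
    (\sum_(J : {set I}) (F J)%:E * (\1_(occ @^-1` [set J]) o)%:E)%E.
  rewrite (bigD1 (occ o))//= big1 ?adde0 => [|J /eqP Jo].
    by rewrite indicE mem_set ?mule1.
  by rewrite indicE memNset ?mule0// => /esym.
have iJ (J : {set I}) : P.-integrable setT (EFin \o \1_(occ @^-1` [set J])).
  by apply: integrable_indic => //; exact: measurable_occ_eq.
rewrite unlock; under eq_integral do rewrite FE.
rewrite integral_sum//; last first.
  by move=> J; exact: (integrableZl measurableT _ (iJ J)).
rewrite -sumEFin; apply: eq_bigr => J _.
rewrite (integralZl _ (iJ J))// integral_indic//; last exact: measurable_occ_eq.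
by rewrite setIT EFinM -occ_law muleC.
Qed.

Lemma occ_probability (S : pred {set I}) :
  P [set o | S (occ o)] =
  (\sum_(J : {set I} | S J) bernoulli_pmf occ_prob J)%:E.
Proof.
have mS : measurable [set o | S (occ o)].
  rewrite (_ : [set _ | _] = \bigcup_(J in [set J | S J]) (occ @^-1` [set J])).
    apply: fin_bigcup_measurable => // J _; exact: measurable_occ_eq.
  apply/seteqP; split=> [ o So|o [J SJ oJ]] /=; last by rewrite oJ.
  by exists (occ o).
rewrite -expectation_indic//.
have -> : \1_[set o | S (occ o)] = (fun J => (S J)%:R) \o occ :> (_ -> R).
  by apply/funext => o; rewrite indicE /= mem_setE.
rewrite occ_expectation [in RHS]big_mkcond/=; congr _%:E; apply: eq_bigr => J _.
by case: (S J); rewrite ?mulr1 ?mulr0.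
Qed.

Variable w : I -> R.

Let M (omega : Omega) : R := \sum_i w i * \1_(X i @^-1` A i) omega.

Lemma weighted_occE : M = (fun J : {set I} => \sum_i w i * (i \in J)%:R) \o occ.
Proof.
apply/funext => o; apply: eq_bigr => i _.
by rewrite indicE inE.
Qed.

Lemma expectation_weighted_occ : 'E_P[M]%E = (\sum_i w i * occ_prob i)%:E.
Proof. by rewrite weighted_occE occ_expectation bernoulli_sum_mean. Qed.

Lemma weighted_occ_centeredE (omega : Omega) : M omega - fine 'E_P[M] =
  \sum_i w i * ((i \in occ omega)%:R - occ_prob i).
Proof.
rewrite expectation_weighted_occ weighted_occE/= -sumrB.
by apply: eq_bigr => i _; rewrite mulrBr.
Qed.

Lemma variance_weighted_occ :
  'V_P[M]%E = (\sum_i w i ^+ 2 * (occ_prob i * (1 - occ_prob i)))%:E.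
Proof.
rewrite /variance unlock -bernoulli_sum_variance -occ_expectation.
congr expectation; apply/funext => o.
by rewrite [LHS]/= !fctE/= weighted_occ_centeredE expr2.
Qed.

Lemma bernstein_weighted_occ (c V x : R) : 0 < c -> (forall i, `|w i| <= c) ->
  ('V_P[M] <= V%:E)%E -> 0 < x ->
  (P [set omega | (x <= `|M omega - fine 'E_P[M]|)%R] <=
   (2 * expR (- (x ^+ 2 / (2 * V + 2 / 3 * c * x))))%:E)%E.
Proof.
rewrite variance_weighted_occ lee_fin => c0 wc vV x0.
under eq_set do rewrite weighted_occ_centeredE.
rewrite (occ_probability (fun J =>
  x <= `|\sum_i w i * ((i \in J)%:R - occ_prob i)|)) lee_fin.
exact: (bernoulli_sum_bernstein_norm _ occ_prob01).
Qed.

End occurrence.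

(** * Bernstein bounds for the discovered mass *)

Theorem theorem3p3 (d : measure_display) (Omega : measurableType d)
  (R : realType) (P : probability Omega R)
  (N : nat) (w p : 'I_N -> R) (lambda : R) (T : 'I_N -> {RV P >-> R})
  (w_gt0 : forall i, 0 < w i) (w_sum1 : \sum_(i < N) w i = 1)
  (p_gt0 : forall i, 0 < p i) (p_sum1 : \sum_(i < N) p i = 1)
  (lambda_gt0 : 0 < lambda)
  (T_indep : independent_RVs T)
  (T_exp : forall i, exponential_RV (lambda * p i) (T i)) :
  forall t : R, 0 <= t ->
    [/\ forall x : R, 0 < x ->
          (P [set omega |
                (x <= `|discovered_mass w T t omega - mean_mass w T t|)%R]
           <= (2 * expR (- (x ^+ 2 /
                 (2 * fine 'V_P[discovered_mass w T t]
                  + 2 / 3 * max_weight w * x))))%:E)%E,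
        ('V_P[discovered_mass w T t] <= (max_weight w)%:E)%E
      & forall x : R, 0 < x ->
          (P [set omega |
                (x <= `|discovered_mass w T t omega - mean_mass w T t|)%R]
           <= (2 * expR (- (x ^+ 2 /
                 (2 * max_weight w + 2 / 3 * max_weight w * x))))%:E)%E ].
Proof.
move=> t _.
(* Type [i] is discovered by time [t] when [T i] falls in [A i], so the discovered mass is the
   weighted sum of occurrences. *)
pose A (i : 'I_N) := [set s : R | s <= t].
have mA i : measurable (A i).
  rewrite (_ : A i = `]-oo, t]%classic); first exact: measurable_itv.
  by apply/seteqP; split=> s; rewrite /A/= in_itv.
have w_le i : w i <= max_weight w by rewrite /max_weight; exact: le_bigmax.
(* An empty sum of weights could not be 1. Having some index makes the maximum positive despite its
   default value 0. *)
have N_gt0 : (0 < N)%N.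
  rewrite lt0n; apply/eqP => N0; move: w_sum1.
  rewrite big1 => [/esym/eqP|[i iN] _]; first by rewrite oner_eq0.
  by exfalso; rewrite N0 in iN.
have c_gt0 : 0 < max_weight w.
  exact: lt_le_trans (w_gt0 (Ordinal N_gt0)) (w_le _).
have w_norm i : `|w i| <= max_weight w by rewrite gtr0_norm.
have VE := variance_weighted_occ T A mA T_indep w.
have V_le : ('V_P[discovered_mass w T t] <= (max_weight w)%:E)%E.
  rewrite VE lee_fin.
  (* Termwise, one factor [w i] is at most the maximum and [q * (1 - q)] is at most 1; the weights
     then sum to 1. *)
  apply: (@le_trans _ _ (\sum_i max_weight w * w i)); last first.
    by rewrite -mulr_sumr w_sum1 mulr1.
  apply: ler_sum => i _; rewrite expr2 -mulrA.
  have /andP[q0 q1] := occ_prob01 T A mA i.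
  apply: ler_pM => //.
  - exact: ltW.
  - by rewrite !mulr_ge0// ?subr_ge0// ltW.
  - rewrite ler_piMr//; first exact: ltW.
    by rewrite mulr_ile1// ?subr_ge0// lerBlDr lerDl.
have bernstein V x := bernstein_weighted_occ T A mA T_indep w (max_weight w) V x
  c_gt0 w_norm.
(* The free bound [V] is taken to be the variance itself, finite by [VE], and then the maximal
   weight, by [V_le]. *)
split=> [x x0||x x0]//; apply: bernstein => //.
by rewrite VE.
Qed.
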